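(* Let $f:X\to Y$ be a continuous surjective map between compact Hausdorff spaces. Then the map $Hf:HX\to HY$ is open if and only if $f$ is open.
   Context: For a compact Hausdorff space $X$, let $HM(X)$ be the set of all maps $\alpha:[0,1)\to X$ for which there exist $0=t_0<t_1<\dots<t_n=1$ such that $\alpha$ is constant on each $[t_i,t_{i+1})$. Let $C(X)$ be the set of continuous real-valued functions on $X$. For $\varphi\in C(X)$ and $0\le a<b\le 1$ define $\varphi_{(a,b)}:HM(X)\to\mathbb{R}$ by $\varphi_{(a,b)}(\alpha)=\frac{1}{b-a}\int_a^b\varphi(\alpha(t))\,dt$, and let $S_{HM}(X)$ be the set of all such functions. The map $\alpha\mapsto(\varphi_{(a,b)}(\alpha))_{\varphi_{(a,b)}\in S_{HM}(X)}$ embeds $HM(X)$ into the product $\prod_{\varphi_{(a,b)}\in S_{HM}(X)}[\min\varphi,\max\varphi]$ (product topology); $HX$ is the closure of the image of $HM(X)$ in this product (a compact Hausdorff space), and $p_{\varphi_{(a,b)}}:HX\to\mathbb{R}$ denotes the restriction of the coordinate projection. For a continuous map $f:X\to Y$, $Hf:HX\to HY$ is the unique continuous map with $p_{\varphi_{(a,b)}}\circ Hf=p_{(\varphi\circ f)_{(a,b)}}$ for all $\varphi\in C(Y)$ and $0\le a<b\le 1$; it extends $\alpha\mapsto f\circ\alpha$ on $HM(X)$. *)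

(* Defs.v *)
From HB Require Import structures.
From mathcomp Require Import all_boot all_order all_algebra.
From mathcomp Require Import all_classical all_reals all_analysis.
Set Implicit Arguments. Unset Strict Implicit. Unset Printing Implicit Defensive.
Import Order.TTheory GRing.Theory Num.Theory.
Import numFieldNormedType.Exports.
Local Open Scope classical_set_scope.
Local Open Scope ring_scope.

(* Index set S_HM(X): triples (phi, a, b) with phi in C(X) and 0 <= a < b <= 1.
   The coordinate function phi_(a,b) is identified with its index. *)
Record shm_index (R : realType) (X : topologicalType) := ShmIdx {
  shm_phi : X -> R;
  shm_a : R;
  shm_b : R;
  shm_cont : continuous shm_phi;
  shm_ab : 0 <= shm_a /\ shm_a < shm_b /\ shm_b <= 1 }.

(* HM(X): maps alpha : [0,1) -> X (represented as maps R -> X, only the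
   values on [0,1) matter) constant on each [t_i, t_{i+1}) for some
   partition 0 = t_0 < t_1 < ... < t_n = 1. *)
Definition is_HM (R : realType) (X : Type) (alpha : R -> X) : Prop :=
  exists (n : nat) (t : nat -> R),
    [/\ t 0%N = 0, t n = 1,
        (forall i, (i < n)%N -> t i < t i.+1) &
        (forall i, (i < n)%N -> exists x : X,
            forall s, t i <= s -> s < t i.+1 -> alpha s = x)].

Definition shm_eval (R : realType) (X : topologicalType)
    (i : shm_index R X) (alpha : R -> X) : R :=
  (shm_b i - shm_a i)^-1 *
    (\int[@lebesgue_measure R]_(t in `[shm_a i, shm_b i]) shm_phi i (alpha t)).

Definition HProd (R : realType) (X : topologicalType) :=
  {ptws shm_index R X -> R}.

Definition H_emb (R : realType) (X : topologicalType) (alpha : R -> X)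
  : HProd R X := fun i => shm_eval i alpha.

Definition HX (R : realType) (X : topologicalType) : set (HProd R X) :=
  closure (H_emb (X := X) @` [set alpha : R -> X | is_HM alpha]).

Definition shm_pull (R : realType) (X Y : topologicalType) (f : X -> Y)
  (hf : continuous f) (i : shm_index R Y) : shm_index R X :=
  @ShmIdx R X (shm_phi i \o f) (shm_a i) (shm_b i)
    (fun x => continuous_comp (hf x) (@shm_cont R Y i (f x))) (shm_ab i).

Definition Hmap (R : realType) (X Y : topologicalType) (f : X -> Y)
  (hf : continuous f) (xi : HProd R X) : HProd R Y :=
  fun i => xi (shm_pull hf i).

Definition open_map_between {T U : topologicalType} (g : T -> U)
  (A : set T) (B : set U) : Prop :=
  forall O : set T, open O ->
    exists O' : set U, open O' /\ g @` (A `&` O) = B `&` O'.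

Definition open_map {T U : topologicalType} (g : T -> U) : Prop :=
  forall O : set T, open O -> open (g @` O).

Arguments HX R X : clear implicits.
Arguments Hmap R X Y f hf xi i : clear implicits.

(* Main.v *)
(** If [f] is open, a point [xi] of [HX] and finitely many coordinates are given.
    Refining the endpoints, one treats a single interval [[u, v)].  Take a
    partition of unity [rho_i] on [X], subordinate to small sets around points
    [c_i], and, since [f] is open and closed, a partition of unity [psi_l] on
    [Y] so fine that a fiber over the support of [psi_l] either meets the small
    set around [c_i] or avoids the support of [rho_i].  A step function [be]
    near [Hf xi] is lifted by cutting each of its steps, of value [y], into
    pieces of proportion [psi_l y * k l i] with values in the fiber over [y]
    near [c_i], where [k l i] is the ratio of the averages of [(psi_l \o f) * rho_i]
    and [psi_l \o f] under [xi].  The averages of the lift are then close to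
    those of [xi], and compactness of [HX] passes from step functions to [HY].
    Conversely, if [Hf] is open, the points [y] whose constant step function
    lies in the image of [{xi | xi(phi_(0,1)) > 1/2}], for [phi] supported in
    [U], form an open set contained in [f(U)]. *)
Require Import Defs.
From HB Require Import structures.
From mathcomp Require Import all_boot all_order all_algebra.
From mathcomp Require Import all_classical all_reals all_analysis.
From mathcomp Require Import measurable_realfun ring lra.
Import Order.TTheory GRing.Theory Num.Theory.
Import numFieldNormedType.Exports.
Local Open Scope classical_set_scope.
Local Open Scope ring_scope.
Set Implicit Arguments. Unset Strict Implicit. Unset Printing Implicit Defensive.

(* [L] lists the (length, value) pairs of the consecutive steps of [al] on
   [[u, v)]; steps of length [0] are allowed. *)
Fixpoint step_on {R : realType} {X : Type} (al : R -> X) (u v : R)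
    (L : seq (R * X)) : Prop :=
  if L is p :: L' then
    [/\ 0 <= p.1, (forall s, u <= s < u + p.1 -> al s = p.2) &
        step_on al (u + p.1) v L']
  else u = v.

(** * Step functions as lists of steps, and their integrals *)

Section StepFunctions.
Context {R : realType} {X : Type}.
Implicit Types (al be : R -> X) (u v w : R) (L : seq (R * X)) (phi : X -> R).

Lemma step_on_le al L u v : step_on al u v L -> u <= v.
Proof.
elim: L u => [|p L IH] u /= => [->//|[p0 _ /IH]].
by apply: le_trans; rewrite lerDl.
Qed.

Lemma step_on_eq al be L u v : (forall s, u <= s < v -> al s = be s) ->
  step_on al u v L -> step_on be u v L.
Proof.
elim: L u => [//|p L IH] u /= ab [p0 c hL]; split => //.
- move=> s /andP[us sp]; rewrite -ab ?c ?us//.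
  by rewrite (lt_le_trans sp (step_on_le hL)).
- apply: IH => // s /andP[us sv]; apply: ab; rewrite sv andbT.
  by apply: le_trans us; rewrite lerDl.
Qed.

Lemma step_on_cat al L1 L2 u v w :
  step_on al u v L1 -> step_on al v w L2 -> step_on al u w (L1 ++ L2).
Proof. by elim: L1 u => [|p L IH] u /= => [->//|[p0 c /IH h /h]]; split. Qed.

Lemma step_on_split al L u v w : step_on al u w L -> u <= v <= w ->
  exists L1 L2, step_on al u v L1 /\ step_on al v w L2.
Proof.
elim: L u => [|p L IH] u /=.
  by move=> <- /le_anti ->; exists [::], [::].
move=> [p0 c hL] /andP[uv vw].
have [pv|vp] := leP (u + p.1) v.
  have [|L1 [L2 [h1 h2]]] := IH _ hL; first by rewrite pv.
  by exists (p :: L1), L2; split.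
exists [:: (v - u, p.2)], ((u + p.1 - v, p.2) :: L); split => /=.
  split; [by rewrite subr_ge0| |by rewrite subrKC].
  move=> s /andP[us]; rewrite subrKC => sv.
  by apply: c; rewrite us (lt_trans sv).
rewrite subrKC; split => //; first by rewrite subr_ge0 ltW.
by move=> s /andP[vs sp]; apply: c; rewrite (le_trans uv vs).
Qed.

(** [is_HM] asks for strictly increasing nodes, so the induction, run over a general nonempty
    interval [[u, v)], drops the steps of length [0]. *)
Lemma step_on_HM al L : step_on al 0 1 L -> is_HM al.
Proof.
suff H u v : u < v -> step_on al u v L -> exists (n : nat) (t : nat -> R),
    [/\ t 0%N = u, t n = v,
        (forall i, (i < n)%N -> t i < t i.+1) &
        (forall i, (i < n)%N -> exists x : X,
            forall s, t i <= s -> s < t i.+1 -> al s = x)].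
  exact: H.
elim: L u => [|p L IH] u /= uv.
  by move=> e; rewrite e ltxx in uv.
move=> [p0 c hL]; move: p0; rewrite le_eqVlt => /predU1P[p0|p0].
  by apply: IH => //; rewrite -p0 addr0 in hL.
(* If the remaining steps all have length [0], the first step alone fills the interval. *)
have := step_on_le hL; rewrite le_eqVlt => /predU1P[e|lt].
  exists 1%N, (fun i => if i is 0 then u else v); split => //.
    by case.
  case=> // _; exists p.2 => s us sv; apply: c; rewrite us/=.
  by rewrite e.
have [n [t [t0 tn ti tc]]] := IH _ lt hL.
exists n.+1, (fun i => if i is j.+1 then t j else u); split => //.
  by case=> [_|i]; [rewrite t0 ltrDl|exact: ti].
case=> [_|i]; last exact: tc.
by exists p.2 => s us; rewrite t0 => sv; apply: c; rewrite us.
Qed.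

Lemma HM_step_on al : is_HM al -> exists L, step_on al 0 1 L.
Proof.
move=> [n [t [t0 tn ti tc]]]; rewrite -tn -t0 {tn t0}.
elim: n t ti tc => [|n IH] t ti tc; first by exists [::].
have [L hL] := IH (t \o S) (fun i => ti i.+1) (fun i => tc i.+1).
have [x hx] := tc 0%N isT.
exists ((t 1%N - t 0%N, x) :: L) => /=; rewrite subrKC; split => //.
  by rewrite subr_ge0 ltW// ti.
by move=> s /andP[]; exact: hx.
Qed.

Lemma HM_step_on_sub al u v : is_HM al -> 0 <= u -> u <= v -> v <= 1 ->
  exists L, step_on al u v L.
Proof.
move=> /HM_step_on[L hL] u0 uv v1.
have [|_ [L2 [_ h2]]] := step_on_split hL (v := u).
  by rewrite u0 (le_trans uv).
have [|L1 [_ [h1 _]]] := step_on_split h2 (v := v); first by rewrite uv.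
by exists L1.
Qed.

(** Integrability travels with the value through the induction, since additivity over two adjacent
    half-open pieces requires it. *)
Lemma step_on_integral al L u v phi : step_on al u v L ->
  (@lebesgue_measure R).-integrable `[u, v[ (EFin \o (phi \o al)) /\
  \int[@lebesgue_measure R]_(t in `[u, v[) phi (al t) =
    \sum_(p <- L) p.1 * phi p.2.
Proof.
elim: L u => [|p L IH] u /=.
  move=> ->; rewrite set_itv_ge ?bnd_simp// big_nil; split.
    exact: integrable_set0.
  exact: Rintegral_set0.
move=> [p0 c hL]; have [iL eL] := IH _ hL; have le := step_on_le hL.
have US : `[u, v[%classic = `[u, u + p.1[ `|` `[u + p.1, v[.
  by apply: itv_bndbnd_setU; rewrite bnd_simp// lerDl.
have ip : (@lebesgue_measure R).-integrable `[u, u + p.1[ (EFin \o (phi \o al)).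
  apply: (@eq_integrable _ _ _ _ _ _ (EFin \o cst (phi p.2))) => //.
    by move=> s; rewrite inE /= in_itv/= => /c ->.
  apply/integrableP; split; first exact/measurable_EFinP.
  by rewrite /= integral_cst//= lebesgue_measure_itv/=; case: ifP => _;
   rewrite -?EFinB -?EFinM ?mule0 ltry.
have disj : [disjoint `[u, u + p.1[ & `[u + p.1, v[]%classic.
  apply/disj_set2P; apply/seteqP; split => // s /=; rewrite !in_itv/=.
  by move=> [/andP[_ sp] /andP[ps _]]; move: (lt_le_trans sp ps); rewrite ltxx.
have iU : (@lebesgue_measure R).-integrable `[u, v[ (EFin \o (phi \o al)).
  move/integrableP : ip => [m1 i1]; move/integrableP : iL => [m2 i2].
  rewrite US; apply/integrableP; split; first exact/measurable_funU.
  rewrite ge0_integral_setU//; first exact: lte_add_pinfty.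
  by apply: measurableT_comp => //; exact/measurable_funU.
split => //.
rewrite US Rintegral_setU -?US//.
rewrite big_cons eL; congr +%R.
rewrite (@eq_Rintegral _ _ _ _ _ (cst (phi p.2))); last first.
  by move=> s; rewrite inE /= in_itv/= => /c ->.
have mE : lebesgue_measure (`[u, u + p.1[%classic : set R) = p.1%:E.
  rewrite lebesgue_measure_itv/= lte_fin; case: ltP => [_|h].
    by rewrite -EFinB addrAC subrr add0r.
  by congr EFin; lra.
by rewrite Rintegral_cst// [X in _ * fine X]mE mulrC.
Qed.

End StepFunctions.

(** * Continuity of real-valued combinations *)

Section RealContinuity.
Context {R : realType} {T : topologicalType}.
Implicit Types (G H : T -> R) (a : R).

Lemma continuous_scale a G : continuous G -> continuous (fun x => a * G x).
Proof. by move=> cG x; apply: cvgM; [exact: cvg_cst|exact: cG]. Qed.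

Lemma continuous_add G H : continuous G -> continuous H ->
  continuous (fun x => G x + H x).
Proof. by move=> cG cH x; apply: cvgD; [exact: cG|exact: cH]. Qed.

Lemma continuous_sub G H : continuous G -> continuous H ->
  continuous (fun x => G x - H x).
Proof. by move=> cG cH x; apply: cvgB; [exact: cG|exact: cH]. Qed.

Lemma continuous_mul G H : continuous G -> continuous H ->
  continuous (fun x => G x * H x).
Proof. by move=> cG cH x; apply: cvgM; [exact: cG|exact: cH]. Qed.

Lemma continuous_norm G : continuous G -> continuous (fun x => `|G x|).
Proof. by move=> cG x; apply: cvg_norm; exact: cG. Qed.

Lemma continuous_sum n (G : 'I_n -> T -> R) : (forall i, continuous (G i)) ->
  continuous (fun x => \sum_i G i x).
Proof.
elim: n G => [|n IH] G cG.
  rewrite (_ : (fun _ => _) = fun=> 0); first exact: cst_continuous.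
  by apply/funext => x; rewrite big_ord0.
rewrite (_ : (fun _ => _) = fun x => G ord0 x + \sum_i G (lift ord0 i) x).
  by apply: continuous_add; [|apply: IH] => *; exact: cG.
by apply/funext => x; rewrite big_ord_recl.
Qed.

End RealContinuity.

(** * The product topology on the space of coordinates *)

Section PointwiseTopology.
Context {I : Type} {R : realType}.

Lemma ptws_coord_continuous (i : I) :
  continuous (fun xi : {ptws I -> R} => xi i).
Proof. exact: (@proj_continuous {classic I} (fun=> R) i). Qed.

Lemma ptws_hausdorff : hausdorff_space {ptws I -> R}.
Proof.
apply: (@hausdorff_product {classic I} (fun=> R)) => _.
exact: norm_hausdorff.
Qed.

Lemma ptws_compact (A : I -> set R) : (forall i, compact (A i)) ->
  compact [set xi : {ptws I -> R} | forall i, A i (xi i)].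
Proof. exact: (@tychonoff {classic I} (fun=> R)). Qed.

Lemma ptws_cvg (F : set_system {ptws I -> R}) (xi : {ptws I -> R}) :
  Filter F -> (forall i, (fun g : {ptws I -> R} => g i) @ F --> xi i) ->
  F --> xi.
Proof.
move=> FF h; apply/cvg_sup => i W /= [V [[U oU <-] Ux]] UW.
apply: filterS UW _; apply: (h i).
exact: open_nbhs_nbhs.
Qed.

(** The sets containing such a box form a filter along which every coordinate converges to that of
    [xi]. By [ptws_cvg] this filter converges to [xi], hence contains each of its neighbourhoods. *)
Lemma ptws_nbhs_box (xi : {ptws I -> R}) (O : set {ptws I -> R}) :
  nbhs xi O -> exists (n : nat) (s : 'I_n -> I) (e : R), 0 < e /\
    (forall g : {ptws I -> R}, (forall j, `|g (s j) - xi (s j)| <= e) -> O g).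
Proof.
pose F : set_system {ptws I -> R} := [set A | exists (n : nat) (s : 'I_n -> I)
    (e : R), 0 < e /\
    (forall g : {ptws I -> R}, (forall j, `|g (s j) - xi (s j)| <= e) -> A g)].
have FF : Filter F.
  split.
  - have s0 : 'I_0 -> I by case.
    by exists 0%N, s0, 1; split.
  - move=> P Q [n [s [e [e0 h]]]] [n' [s' [e' [e'0 h']]]].
    pose t (j : 'I_(n + n')) :=
      match fintype.split j with inl k => s k | inr k => s' k end.
    exists (n + n')%N, t, (Num.min e e').
    rewrite lt_min e0 e'0; split => // g hg.
    split; [apply: h|apply: h'] => j.
      apply: (@le_trans _ _ (Num.min e e')); last by rewrite ge_min lexx.
      by have := hg (unsplit (inl j)); rewrite /t unsplitK.
    apply: (@le_trans _ _ (Num.min e e')); last by rewrite ge_min lexx orbT.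
    by have := hg (unsplit (inr j)); rewrite /t unsplitK.
  - by move=> P Q PQ [n [s [e [e0 h]]]]; exists n, s, e; split => // g /h /PQ.
suff h : F --> xi by exact: h.
apply: ptws_cvg => i; apply/cvgrPdist_le => /= e e0.
by exists 1%N, (fun=> i), e; split => // g /(_ ord0); rewrite distrC.
Qed.

End PointwiseTopology.

(** * Coordinates of points of [HX] as positive normalised linear functionals *)

Section Coordinates.
Context {R : realType} {X : topologicalType}.
Implicit Types (xi : HProd R X) (phi psi : X -> R) (u v w : R).

Definition subunit u v : Prop := 0 <= u /\ u < v /\ v <= 1.

(* [ev xi u v phi] is the coordinate of [xi] at phi_(u,v), and the junk value
   [0] when [phi] is discontinuous or [(u, v)] is not a subinterval of [0,1]. *)
Definition ev xi u v phi : R :=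
  if pselect (continuous phi /\ subunit u v) is left h
  then xi (ShmIdx h.1 h.2) else 0.

(** Indices with the same function and endpoints agree by proof irrelevance, so [ev], which takes no
    proofs as arguments, captures every coordinate. *)
Lemma ev_idx xi (i : shm_index R X) :
  xi i = ev xi (shm_a i) (shm_b i) (shm_phi i).
Proof.
rewrite /ev; case: pselect => [h|nh]; last by case: nh; case: i.
congr xi; case: i h => phi a b hc hab /= h.
by congr ShmIdx; exact: Prop_irrelevance.
Qed.

Lemma evE xi u v phi (hc : continuous phi) (huv : subunit u v) :
  ev xi u v phi = xi (ShmIdx hc huv).
Proof. by rewrite [RHS]ev_idx. Qed.

Lemma ev_continuous u v phi : continuous (fun xi => ev xi u v phi).
Proof.
rewrite /ev; case: pselect => [h|nh]; first exact: ptws_coord_continuous.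
exact: cst_continuous.
Qed.

Lemma ev_emb (al : R -> X) L u v phi : continuous phi -> subunit u v ->
  step_on al u v L ->
  ev (H_emb al) u v phi = (v - u)^-1 * \sum_(p <- L) p.1 * phi p.2.
Proof.
move=> hc huv hL; have [ial <-] := step_on_integral phi hL.
rewrite (evE _ hc huv).
(* The endpoint [v] is a null set, so [[u, v]] may be replaced by [[u, v)]. *)
by rewrite /H_emb /shm_eval/= Rintegral_itv_bndo_bndc.
Qed.

(** A closed condition true on step functions passes to their closure. The properties of [ev] below
    are identities or inequalities of finite sums transferred in this way. *)
Lemma HX_ge0 (G : HProd R X -> R) : continuous G ->
  (forall al, is_HM al -> 0 <= G (H_emb al)) -> forall xi, HX R X xi -> 0 <= G xi.
Proof.
move=> cG hG.
have cl : closed (G @^-1` [set r | 0 <= r]).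
  by apply: preimage_closed; [move=> x _; exact: cG|exact: closed_ge].
move=> xi; rewrite /HX => hxi; suff : (G @^-1` [set r | 0 <= r]) xi by [].
rewrite (iffLR (closure_id _) cl); apply: closureS hxi.
by move=> _ [al hal <-]; exact: hG.
Qed.

Lemma HX_eq (G H : HProd R X -> R) : continuous G -> continuous H ->
  (forall al, is_HM al -> G (H_emb al) = H (H_emb al)) ->
  forall xi, HX R X xi -> G xi = H xi.
Proof.
move=> cG cH e xi hxi; apply/eqP; rewrite eq_le; apply/andP; split;
  rewrite -subr_ge0.
  apply: (@HX_ge0 (fun x => H x - G x)) hxi => [|al hal].
    exact: continuous_sub.
  by rewrite e // subrr.
apply: (@HX_ge0 (fun x => G x - H x)) hxi => [|al hal].
  exact: continuous_sub.
by rewrite e // subrr.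
Qed.

Lemma HX_emb al : is_HM al -> HX R X (H_emb al).
Proof. by move=> hal; apply: subset_closure; exists al. Qed.

Section Functional.
Variables (xi : HProd R X) (hxi : HX R X xi) (u v : R) (huv : subunit u v).

Let HM_list (al : R -> X) : is_HM al -> exists L, step_on al u v L.
Proof. by case: huv => u0 [uv v1] hal; exact: HM_step_on_sub (ltW uv) v1. Qed.

Lemma ev_lin a phi psi : continuous phi -> continuous psi ->
  ev xi u v (fun x => a * phi x + psi x) = a * ev xi u v phi + ev xi u v psi.
Proof.
move=> cp cq; move: xi hxi; apply: HX_eq.
- exact: ev_continuous.
- by apply: continuous_add; [apply: continuous_scale|]; exact: ev_continuous.
- move=> al hal; have [L hL] := HM_list hal.
  rewrite !(ev_emb _ huv hL)//; last first.
    by apply: continuous_add => //; exact: continuous_scale.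
  rewrite (_ : \sum_(p <- L) _ = a * (\sum_(p <- L) p.1 * phi p.2)
                                 + \sum_(p <- L) p.1 * psi p.2); first by ring.
  by rewrite mulr_sumr -big_split/=; apply: eq_bigr => p _; ring.
Qed.

Lemma ev_ge0 phi : continuous phi -> (forall x, 0 <= phi x) -> 0 <= ev xi u v phi.
Proof.
move=> cp p0; move: xi hxi; apply: HX_ge0; first exact: ev_continuous.
move=> al hal; have [L hL] := HM_list hal; rewrite (ev_emb cp huv hL).
apply: mulr_ge0; first by rewrite invr_ge0 subr_ge0 ltW//; case: huv => _ [].
elim: L (u) hL => [|p L IH] w /=; first by rewrite big_nil.
by case=> p10 _ /IH h; rewrite big_cons addr_ge0// mulr_ge0.
Qed.

Lemma ev_cst c : ev xi u v (fun=> c) = c.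
Proof.
have cc : continuous (fun _ : X => c) by exact: cst_continuous.
move: xi hxi; apply: (@HX_eq _ (fun=> c)); first exact: ev_continuous.
  exact: cst_continuous.
move=> al hal; have [L hL] := HM_list hal; rewrite (ev_emb cc huv hL).
have -> : \sum_(p <- L) p.1 * c = (v - u) * c.
  rewrite -mulr_suml; congr (_ * _).
  elim: L (u) hL => [|p L IH] w /=; first by move=> ->; rewrite big_nil subrr.
  by case=> _ _ /IH; rewrite big_cons => ->; ring.
by rewrite mulKf// subr_eq0 gt_eqF//; case: huv => _ [].
Qed.

Lemma ev_sum n (c : 'I_n -> R) (phi : 'I_n -> X -> R) :
  (forall i, continuous (phi i)) ->
  ev xi u v (fun x => \sum_i c i * phi i x) = \sum_i c i * ev xi u v (phi i).
Proof.
elim: n c phi => [|n IH] c phi cp.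
  rewrite big_ord0 -[RHS](ev_cst 0); congr ev.
  by apply/funext => x; rewrite big_ord0.
rewrite big_ord_recl -IH// -ev_lin//; last first.
  by apply: continuous_sum => i; exact: continuous_scale.
by congr ev; apply/funext => x; rewrite big_ord_recl.
Qed.

Lemma ev_le phi psi : continuous phi -> continuous psi ->
  (forall x, phi x <= psi x) -> ev xi u v phi <= ev xi u v psi.
Proof.
move=> cp cq pq; rewrite -subr_ge0.
have -> : ev xi u v psi - ev xi u v phi =
    ev xi u v (fun x => -1 * phi x + psi x) by rewrite ev_lin//; ring.
apply: ev_ge0 => [|x]; last by rewrite mulN1r addrC subr_ge0.
by apply: continuous_add => //; exact: continuous_scale.
Qed.

End Functional.

(** Multiplying by the lengths undoes the normalisation and leaves additivity of the integral. It
    serves to glue estimates on adjacent intervals. *)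
Lemma ev_concat xi u v w phi : HX R X xi -> continuous phi ->
  0 <= u -> u < v -> v < w -> w <= 1 ->
  (w - u) * ev xi u w phi = (v - u) * ev xi u v phi + (w - v) * ev xi v w phi.
Proof.
move=> hxi cp u0 uv vw w1; have uw := lt_trans uv vw.
have huv : subunit u v by split => //; split => //; rewrite ltW// (lt_le_trans vw).
have hvw : subunit v w by split => //; rewrite ltW// (le_lt_trans u0).
have huw : subunit u w by [].
move: xi hxi; apply: HX_eq => [||al hal].
- by apply: continuous_scale; exact: ev_continuous.
- by apply: continuous_add; apply: continuous_scale; exact: ev_continuous.
have [L1 h1] := HM_step_on_sub hal u0 (ltW uv) (huv.2.2).
have [L2 h2] := HM_step_on_sub hal hvw.1 (ltW vw) w1.
rewrite (ev_emb cp huv h1) (ev_emb cp hvw h2).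
rewrite (ev_emb cp huw (step_on_cat h1 h2)) big_cat/=.
by rewrite !mulVKf ?subr_eq0 ?gt_eqF.
Qed.

End Coordinates.

(** * The map [Hmap] on coordinates and on step functions *)

Section Functoriality.
Context {R : realType} {X Y : topologicalType} (f : X -> Y) (hf : continuous f).

Lemma ev_Hmap xi u v psi : continuous psi ->
  ev (Hmap R X Y f hf xi) u v psi = ev xi u v (psi \o f).
Proof.
move=> cp; have cpf : continuous (psi \o f).
  by move=> x; apply: continuous_comp; [exact: hf|exact: cp].
have [huv|nuv] := pselect (subunit u v).
  by rewrite (evE _ cp huv); exact: (ev_idx xi (shm_pull hf (ShmIdx cp huv))).
(* Outside the subintervals of [0,1] both sides are the default value [0]. *)
by rewrite /ev; case: pselect => [[]//|_]; case: pselect => [[]//|].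
Qed.

Lemma Hmap_emb al : Hmap R X Y f hf (H_emb al) = H_emb (f \o al).
Proof. by []. Qed.

Lemma Hmap_continuous : continuous (Hmap R X Y f hf : HProd R X -> HProd R Y).
Proof.
move=> xi.
have FF : Filter (Hmap R X Y f hf @ nbhs (xi : HProd R X)).
  by apply: fmap_filter; exact: nbhs_filter.
have h i : (fun g : {ptws shm_index R Y -> R} => g i) @
    (Hmap R X Y f hf @ nbhs (xi : HProd R X)) --> Hmap R X Y f hf xi i.
  exact: (@ptws_coord_continuous _ R (shm_pull hf i) xi).
exact: (@ptws_cvg (shm_index R Y) R _ (Hmap R X Y f hf xi) FF h).
Qed.

Lemma HM_comp (al : R -> X) : is_HM al -> is_HM (f \o al).
Proof.
move=> [n [t [t0 tn ti tc]]]; exists n, t; split => // i /tc[x hx].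
by exists (f x) => s a b; rewrite /= (hx s).
Qed.

Lemma Hmap_HX xi : HX R X xi -> HX R Y (Hmap R X Y f hf xi).
Proof.
move=> hxi W hW; have [_ [[al hal <-] aW]] := hxi _ (Hmap_continuous hW).
by exists (H_emb (f \o al)); split => //; exists (f \o al) => //; exact: HM_comp.
Qed.

End Functoriality.

(** * Partitions of unity and Urysohn functions *)

Section PartitionOfUnity.
Context {R : realType} {T : topologicalType}.

(** The near-covering form of compactness is applied to the filter of finite lists directed by
    inclusion: at the points of [U x], every list containing [x] will do. *)
Lemma compact_finite_cover (U : T -> set T) : compact [set: T] ->
  (forall x, nbhs x (U x)) -> exists s : seq T, forall x, exists2 p, p \in s & U p x.
Proof.
move=> /compact_near_coveringP cT nU.
pose F : set_system (seq T) :=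
  [set A | exists s : seq T, forall s' : seq T, {subset s <= s'} -> A s'].
have FF : Filter F.
  split; first by exists [::].
  - move=> P Q [s hs] [s' hs']; exists (s ++ s') => t st; split.
      by apply: hs => x xs; apply: st; rewrite mem_cat xs.
    by apply: hs' => x xs; apply: st; rewrite mem_cat xs orbT.
  - by move=> P Q PQ [s hs]; exists s => t /hs /PQ.
have [|s hs] := cT _ F (fun s x => exists2 p, p \in s & U p x) FF.
  move=> x _; exists (U x, [set s : seq T | x \in s]).
    by split => //; exists [:: x] => s /(_ x); apply; rewrite mem_head.
  by move=> [z s] [/= Uz xs]; exists x.
by exists s => x; exact: (hs s).
Qed.

(** Finitely many of the sets where [h p] is positive cover the space, so the sum [S] of the
    corresponding functions is positive and can be divided out. *)
Lemma partition_of_unity (h : T -> T -> R) : compact [set: T] ->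
  (forall p, continuous (h p)) -> (forall p x, 0 <= h p x) ->
  (forall p, 0 < h p p) ->
  exists (n : nat) (c : 'I_n -> T) (rho : 'I_n -> T -> R),
    [/\ forall i, continuous (rho i), forall i x, 0 <= rho i x,
        forall x, \sum_i rho i x = 1 &
        forall i x, rho i x != 0 -> 0 < h (c i) x].
Proof.
move=> cT ch h0 hp.
have [|s hs] := @compact_finite_cover (fun p => [set x | 0 < h p x]) cT.
  move=> p; apply: open_nbhs_nbhs; split => //; last exact: hp.
  have : open (h p @^-1` [set r | 0 < r]); last by [].
  by apply: open_comp => [x _|]; [exact: ch|exact: open_gt].
pose c (i : 'I_(size s)) := tnth (in_tuple s) i.
pose S x := \sum_i h (c i) x.
have S0 x : 0 < S x.
  have [p ps px] := hs x.
  have /tnthP[i ip] : p \in in_tuple s by [].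
  rewrite /S (bigD1 i)//=; apply: ltr_pwDl; last exact: sumr_ge0.
  by rewrite /c -ip.
have cS : continuous S by apply: continuous_sum => i; exact: ch.
exists (size s), c, (fun i x => h (c i) x * (S x)^-1); split.
- move=> i; apply: continuous_mul => // x.
  by apply: cvgV; [exact: lt0r_neq0|exact: cS].
- by move=> i x; rewrite mulr_ge0// invr_ge0 ltW.
- by move=> x; rewrite -mulr_suml; exact: divff (lt0r_neq0 (S0 x)).
- by move=> i x hx; rewrite lt_def h0 andbT; apply: contraNneq hx => ->;
    rewrite mul0r.
Qed.

(** Compact Hausdorff spaces are normal, so the closed set [[set y]] can be separated from the
    complement of the interior of [W]. *)
Lemma urysohn_bump (y : T) (W : set T) : compact [set: T] -> hausdorff_space T ->
  nbhs y W -> exists h : T -> R, [/\ continuous h, forall x, 0 <= h x <= 1,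
    h y = 1 & forall x, h x != 0 -> W x].
Proof.
move=> cT hT yW.
have sep : uniform_separator (~` W°) [set y].
  apply: (iffLR (@normal_separatorP R T) (compact_normal hT cT)).
  - exact/open_closedC/open_interior.
  - exact/accessible_closed_set1/hausdorff_accessible.
  - by apply/seteqP; split => // z [/[swap] -> nW]; exact: nW.
have [h [ch h01 hA hB]] := iffLR (@uniform_separatorP T R _ _) sep.
exists h; split => //.
- by move=> x; have /(_ (h x)) := h01; rewrite /= in_itv/=; apply; exists x.
- by apply: hB; exists y.
- move=> x hx; apply: interior_subset; apply: contrapT => nW.
  by case/eqP: hx; apply: hA; exists x.
Qed.

End PartitionOfUnity.

(** * Lifting step functions with prescribed proportions in each fiber *)

Section Lifting.
Context {R : realType} {X Y : choiceType} (f : X -> Y) (g : Y -> X).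
Hypothesis fg : forall y, f (g y) = y.

Lemma step_lift_piece (y : Y) (D : seq (R * X)) (u : R) :
  (forall p, p \in D -> 0 <= p.1 /\ f p.2 = y) ->
  exists al : R -> X, (forall s, f (al s) = y) /\
    step_on al u (u + \sum_(p <- D) p.1) D.
Proof.
elim: D u => [|p D IH] u hD.
  by exists (fun=> g y); rewrite big_nil /= addr0.
have [|al [fal hal]] := IH (u + p.1).
  by move=> q qD; apply: hD; rewrite inE qD orbT.
have [p0 fp] := hD p (mem_head _ _).
exists (fun s => if s < u + p.1 then p.2 else al s); split.
  by move=> s; case: ifP.
rewrite big_cons addrA /=; split => //; first by move=> s /andP[_ ->].
by apply: step_on_eq hal => s /andP[us _]; rewrite ltNge us.
Qed.

(** A step of length [q.1] and value [q.2] is cut into the pieces of [D q.2] scaled by [q.1]; they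
    fill it exactly because the proportions add up to [1]. Outside [[u, v)] the lift is [g \o be],
    so it lies over [be] everywhere. *)
Lemma step_lift (D : Y -> seq (R * X)) (be : R -> Y) L (u v : R) :
  (forall y p, p \in D y -> 0 <= p.1 /\ f p.2 = y) ->
  (forall y, \sum_(p <- D y) p.1 = 1) ->
  step_on be u v L ->
  exists al : R -> X, (forall s, f (al s) = be s) /\
    exists L', step_on al u v L' /\ forall phi : X -> R,
      \sum_(q <- L') q.1 * phi q.2 =
      \sum_(q <- L) q.1 * \sum_(p <- D q.2) p.1 * phi p.2.
Proof.
move=> hD D1; elim: L u => [|q L IH] u /=.
  move=> ->; exists (g \o be); split; first by move=> s; exact: fg.
  by exists [::]; split => // phi; rewrite !big_nil.
move=> [q0 qc /IH[al [fal [L' [hL' eL']]]]].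
pose Dq := [seq (q.1 * p.1, p.2) | p <- D q.2].
have [|al0 [fal0 hal0]] := @step_lift_piece q.2 Dq u.
  move=> p /mapP[r rD ->] /=; have [r0 fr] := hD _ _ rD.
  by split => //; exact: mulr_ge0.
have eq : \sum_(p <- Dq) p.1 = q.1 by rewrite big_map/= -mulr_sumr D1 mulr1.
rewrite eq in hal0.
exists (fun s => if u <= s < u + q.1 then al0 s else al s); split.
  by move=> s; case: ifP => [/qc ->|_].
exists (Dq ++ L'); split.
  apply: step_on_cat.
    by apply: step_on_eq hal0 => s ->.
  by apply: step_on_eq hL' => s /andP[us _]; rewrite [s < _]ltNge us andbF.
move=> phi; rewrite big_cat big_cons/= eL'; congr (_ + _).
by rewrite big_map mulr_sumr; apply: eq_bigr => p _; rewrite mulrA.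
Qed.

End Lifting.

(** * A uniform bound on averages of steps *)

Section StepAverages.
Context {R : realType} {X : Type}.

Lemma step_avg_le (al : R -> X) L (u v e : R) (F : X -> R) : u < v ->
  step_on al u v L -> (forall x, `|F x| <= e) ->
  `|(v - u)^-1 * \sum_(p <- L) p.1 * F p.2| <= e.
Proof.
move=> uv hL Fe; have vu : 0 < v - u by rewrite subr_gt0.
rewrite normrM gtr0_norm ?invr_gt0// mulrC ler_pdivrMr//.
elim: L (u) hL => [|p L IH] w /=.
  by move=> ->; rewrite big_nil normr0 subrr mulr0.
case=> p0 _ /IH h; rewrite big_cons; apply: le_trans (ler_normD _ _) _.
have -> : e * (v - w) = p.1 * e + e * (v - (w + p.1)) by ring.
by apply: lerD => //; rewrite normrM ger0_norm// ler_wpM2l.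
Qed.

End StepAverages.

(** * Approximate lifting over one interval, then over a chain of intervals *)

Section IntervalLifting.
Context {R : realType} {X Y : topologicalType}.
Hypotheses (cX : compact [set: X]) (cY : compact [set: Y]) (hY : hausdorff_space Y).
Variables (f : X -> Y) (hf : continuous f) (g : Y -> X).
Hypotheses (fg : forall y, f (g y) = y) (fopen : open_map f).
Variables (n : nat) (phi : 'I_n -> X -> R).
Hypothesis cphi : forall j, continuous (phi j).
Variables (xi : HProd R X) (hxi : HX R X xi).

Definition approx_on (e : R) (al : R -> X) (u v : R) : Prop :=
  exists L, step_on al u v L /\ forall j,
    `|(v - u)^-1 * (\sum_(p <- L) p.1 * phi j p.2) - ev xi u v (phi j)| <= e.

(** The pseudometric generated by the finitely many test functions [phi j]; it measures smallness of
    sets in [X]. *)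
Let dist x x' := \sum_j `|phi j x' - phi j x|.

Let dist_cont x : continuous (dist x).
Proof.
apply: continuous_sum => j x'; apply: cvg_norm.
by apply: cvgB; [exact: cphi|exact: cvg_cst].
Qed.

Let dist_ge j x x' : `|phi j x' - phi j x| <= dist x x'.
Proof. by rewrite /dist (bigD1 j)//= lerDl sumr_ge0. Qed.

(** Twice the positive part of [e - dist x x'], hence continuous and positive exactly on the open
    [e]-ball. *)
Let bump e x x' : R := (e - dist x x') + `|e - dist x x'|.

Let bump_gt0 e x x' : 0 < bump e x x' -> dist x x' < e.
Proof. by rewrite /bump; case: (ler0P (e - dist x x')) => h; lra. Qed.

(** [C i] is the image of the closed [e]-ball around [c i], closed by compactness; [U i] is the
    image of the open [2 * e]-ball, open because [f] is. The point [z i y] is taken in the larger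
    ball if the fiber over [y] meets it, and anywhere in the fiber otherwise. *)
Lemma fiber_partition (e : R) : 0 < e ->
  exists (r : nat) (c : 'I_r -> X) (rho : 'I_r -> X -> R) (C : 'I_r -> set Y)
      (U : 'I_r -> set Y) (z : 'I_r -> Y -> X),
  [/\ [/\ forall i, continuous (rho i), forall i x, 0 <= rho i x &
        forall x, \sum_i rho i x = 1],
      forall i j x, rho i x != 0 -> `|phi j x - phi j (c i)| <= e,
      forall i x, rho i x != 0 -> C i (f x),
      forall i, [/\ closed (C i), open (U i) & C i `<=` U i] &
      forall i y, f (z i y) = y /\
        (U i y -> forall j, `|phi j (z i y) - phi j (c i)| <= 2 * e)].
Proof.
move=> e0.
have [|p x|p|r [c [rho [crho rho0 rho1 hrho]]]] :=
    partition_of_unity (h := bump e) cX.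
- move=> p x; apply: cvgD; last apply: cvg_norm;
    by apply: cvgB; [exact: cvg_cst|exact: dist_cont].
- by rewrite /bump; case: (ler0P (e - dist p x)) => h; lra.
- suff d0 : dist p p = 0 by rewrite /bump d0 subr0 gtr0_norm ?addr_gt0.
  by apply: big1 => j _; rewrite subrr normr0.
have hz (iy : 'I_r * Y) : exists x, f x = iy.2 /\
    ((f @` [set x | dist (c iy.1) x < 2 * e]) iy.2 -> dist (c iy.1) x < 2 * e).
  case: iy => i y /=.
  have [[x dx fx]|nh] := pselect ((f @` [set x | dist (c i) x < 2 * e]) y).
    by exists x.
  by exists (g y).
have {hz}[z hz] := choice hz.
exists r, c, rho, (fun i => f @` [set x | dist (c i) x <= e]),
  (fun i => f @` [set x | dist (c i) x < 2 * e]), (fun i y => z (i, y)); split.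
- by split.
- by move=> i j x /hrho/bump_gt0/ltW; apply: le_trans.
- by move=> i x /hrho/bump_gt0/ltW h; exists x.
- move=> i; split.
  + apply: compact_closed => //; apply: continuous_compact.
      exact: continuous_subspaceT.
    apply: (subclosed_compact _ cX) => //.
    have : closed (dist (c i) @^-1` [set t | t <= e]); last by [].
    by apply: preimage_closed; [move=> x _; exact: dist_cont|exact: closed_le].
  + apply: fopen.
    have : open (dist (c i) @^-1` [set t | t < 2 * e]); last by [].
    by apply: open_comp; [move=> x _; exact: dist_cont|exact: open_lt].
  + by move=> _ [x /= dx <-]; exists x => //=; lra.
- move=> i y; have [fz hU] := hz (i, y); split => // /hU/ltW h j.
  exact: le_trans (dist_ge _ _ _) h.
Qed.

(** The error [4 * e] consists of [2 * e] for replacing the fiber points [z i y] by the centers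
    [c i], [e] for replacing [eta] by the image of [xi], and [e] for replacing [phi j] by its values
    at the centers. *)
Lemma interval_lift (u v e : R) : subunit u v -> 0 < e ->
  \forall eta \near (Hmap R X Y f hf xi : HProd R Y),
    forall be : R -> Y, is_HM be -> H_emb be = eta ->
    exists al : R -> X, (forall s, f (al s) = be s) /\ approx_on (4 * e) al u v.
Proof.
move=> huv e0.
have [r [c [rho [C [U [z [[crho rho0 rho1] hphi hC hCU hz]]]]]]] :=
  fiber_partition e0.
(* On [W y] each index [i] behaves uniformly: either all fibers meet the [2 * e]-ball around [c i],
   or all avoid the support of [rho i]. *)
pose W y := [set y' | forall i, (C i y -> U i y') /\ (~ C i y -> ~ C i y')].
have nW y : nbhs y (W y).
  apply: filter_forall => i; have [cC oU CU] := hCU i.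
  have [Cy|nCy] := pselect (C i y).
    have : nbhs y (U i) by apply: open_nbhs_nbhs; split => //; exact: CU.
    by apply: filterS => y' Uy'; split.
  have : nbhs y (~` C i) by apply: open_nbhs_nbhs; split => //; exact: closed_openC.
  by apply: filterS => y' Cy'; split.
have [h hh] := choice (fun y => @urysohn_bump R Y y (W y) cY hY (nW y)).
have [||y|l0 [d [psi [cpsi psi0 psi1 hpsi]]]] := partition_of_unity (h := h) cY.
- by move=> y; case: (hh y).
- by move=> y x; case: (hh y) => _ /(_ x)/andP[].
- by case: (hh y) => _ _ ->.
have {}hpsi l y : psi l y != 0 -> W (d l) y.
  move=> /hpsi hd; case: (hh (d l)) => _ _ _; apply.
  exact: lt0r_neq0.
have cpf l : continuous (psi l \o f).
  by move=> x; apply: continuous_comp; [exact: hf|exact: cpsi].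
pose th l i x := psi l (f x) * rho i x.
have cth l i : continuous (th l i).
  exact: (continuous_mul (cpf l) (crho i)).
pose m l i := ev xi u v (th l i).
pose M l := ev xi u v (psi l \o f).
have m0 l i : 0 <= m l i by apply: ev_ge0 => // x; exact: mulr_ge0.
have mM l : \sum_i m l i = M l.
  under eq_bigr do rewrite -[m _ _]mul1r.
  rewrite -(ev_sum hxi huv)//.
  congr ev; apply/funext => x /=; under eq_bigr do rewrite mul1r.
  by rewrite -mulr_sumr rho1 mulr1.
(* When [M l = 0] the ratio is replaced by weights that still satisfy [kC]. *)
pose k l i := if M l == 0 then rho i (g (d l)) else m l i / M l.
have k0 l i : 0 <= k l i.
  by rewrite /k; case: ifP => // _; rewrite divr_ge0// -mM sumr_ge0.
have k1 l : \sum_i k l i = 1.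
  rewrite /k; case: (eqVneq (M l) 0) => [_|Ml]; first exact: rho1.
  by rewrite -mulr_suml mM divff.
(* If [M l] vanishes, so does [m l i], being a nonnegative summand of it. *)
have Mk l i : M l * k l i = m l i.
  rewrite /k; case: (eqVneq (M l) 0) => [Ml|Ml]; last by rewrite mulrC divfK.
  rewrite Ml mul0r; apply/esym/eqP; rewrite eq_le m0 andbT -Ml -mM.
  by rewrite (bigD1 i)//= lerDl sumr_ge0.
(* If [d l] is outside [C i], fibers over the support of [psi l] avoid the support of [rho i], so
   [th l i] is identically [0]. *)
have kC l i : k l i != 0 -> C i (d l).
  rewrite /k; case: (eqVneq (M l) 0) => [_ r0|Ml mn].
    by rewrite -(fg (d l)); exact: hC.
  apply: contrapT => nC; move/eqP: mn; apply; rewrite (_ : m l i = 0) ?mul0r//.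
  rewrite /m (_ : th l i = fun=> 0) ?ev_cst//; apply/funext => x; apply/eqP.
  apply: contra_notT nC; rewrite mulf_eq0 negb_or => /andP[/hpsi/(_ i)[_ h2] rx].
  by apply: contrapT => /h2; apply; exact: hC.
have kU l i y : psi l y * k l i != 0 -> U i y.
  by rewrite mulf_eq0 negb_or => /andP[/hpsi/(_ i)[h1 _] kli]; exact/h1/kC.
(* The mean of [phi j] over the pieces attached to [psi l], with values read at the centers. It
   turns the averages of the lift into a combination of finitely many coordinates of [eta]. *)
pose kap j l := \sum_i k l i * phi j (c i).
have near_eta : \forall eta \near (Hmap R X Y f hf xi : HProd R Y), forall j,
    `|\sum_l kap j l * ev eta u v (psi l) - \sum_l kap j l * M l| <= e.
  have FF := nbhs_filter (Hmap R X Y f hf xi : HProd R Y).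
  apply: (@filter_forall _ _ _ _ FF) => j.
  pose G (eta : HProd R Y) := \sum_l kap j l * ev eta u v (psi l).
  have cG : continuous G.
    by apply: continuous_sum => l; apply: continuous_scale; exact: ev_continuous.
  have -> : \sum_l kap j l * M l = G (Hmap R X Y f hf xi).
    by apply: eq_bigr => l _; rewrite ev_Hmap.
  have /cvgrPdist_le/(_ e e0) := cG (Hmap R X Y f hf xi).
  by apply: filterS => eta; rewrite distrC.
apply: filterS near_eta => eta heta be hbe ebe.
have [u0 [uv v1]] := huv.
have [L hL] := HM_step_on_sub hbe u0 (ltW uv) v1.
pose D y := [seq (psi p.1 y * k p.1 p.2, z p.2 y) | p : 'I_l0 * 'I_r].
have DE y F : \sum_(p <- D y) p.1 * F p.2 =
    \sum_l \sum_i psi l y * k l i * F (z i y).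
  by rewrite /D big_image/= pair_bigA.
have D1 y : \sum_(p <- D y) p.1 = 1.
  under eq_bigr do rewrite -[_.1]mulr1.
  rewrite (DE y (fun=> 1)) -[RHS](psi1 y); apply: eq_bigr => l _.
  by under eq_bigr do rewrite mulr1; rewrite -mulr_sumr k1 mulr1.
have hD y p : p \in D y -> 0 <= p.1 /\ f p.2 = y.
  move=> /mapP[[l i] _ ->] /=.
  by split; [exact: mulr_ge0|case: (hz i y)].
have [al [fal [L' [hL' eL']]]] := step_lift fg hD D1 hL.
exists al; split => //; exists L'; split => // j.
rewrite eL'.
have lift_err y :
    `|\sum_(p <- D y) p.1 * phi j p.2 - \sum_l kap j l * psi l y| <= 2 * e.
  rewrite DE; under [X in _ - X]eq_bigr do rewrite mulr_suml.
  rewrite -sumrB; apply: le_trans (ler_norm_sum _ _ _) _.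
  have -> : 2 * e = \sum_l \sum_i psi l y * k l i * (2 * e).
    rewrite -[LHS]mul1r -(psi1 y) mulr_suml; apply: eq_bigr => l _.
    by rewrite -mulr_suml -mulr_sumr k1 mulr1.
  apply: ler_sum => l _; rewrite -sumrB; apply: le_trans (ler_norm_sum _ _ _) _.
  apply: ler_sum => i _.
  rewrite (_ : _ - _ = psi l y * k l i * (phi j (z i y) - phi j (c i)));
    last by ring.
  rewrite normrM ger0_norm ?mulr_ge0//.
  have [->|/kU Uy] := eqVneq (psi l y * k l i) 0; first by rewrite !mul0r.
  by rewrite ler_wpM2l ?mulr_ge0//; case: (hz i y) => _; exact.
have be_avg : (v - u)^-1 * \sum_(q <- L) q.1 * (\sum_l kap j l * psi l q.2) =
    \sum_l kap j l * ev eta u v (psi l).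
  under eq_bigr do rewrite mulr_sumr.
  rewrite exchange_big mulr_sumr; apply: eq_bigr => l _.
  rewrite -ebe (ev_emb (cpsi l) huv hL) mulrCA; congr (_ * _).
  by rewrite mulr_sumr; apply: eq_bigr => q _; rewrite mulrCA.
(* [F] is [phi j] discretised along the partition [rho]; by [Mk] its average under [xi] is exactly
   the combination of the [M l] with weights [kap j l]. *)
pose F x := \sum_i phi j (c i) * rho i x.
have cF : continuous F by apply: continuous_sum => i; exact: continuous_scale.
have FE : \sum_l kap j l * M l = ev xi u v F.
  rewrite /F ev_sum//.
  under eq_bigr do rewrite mulr_suml.
  rewrite exchange_big; apply: eq_bigr => i _ /=.
  have -> : ev xi u v (rho i) = \sum_l m l i.
    under [RHS]eq_bigr do rewrite -[m _ _]mul1r.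
    rewrite -(ev_sum hxi huv)//.
    congr ev; apply/funext => x; under eq_bigr do rewrite mul1r.
    by rewrite -mulr_suml psi1 mul1r.
  by rewrite mulr_sumr; apply: eq_bigr => l _; rewrite -Mk; ring.
have Fphi x : `|F x - phi j x| <= e.
  have -> : F x - phi j x = \sum_i rho i x * (phi j (c i) - phi j x).
    rewrite -[X in _ - X]mul1r -(rho1 x) mulr_suml -sumrB.
    by apply: eq_bigr => i _; ring.
  apply: le_trans (ler_norm_sum _ _ _) _.
  rewrite -[leRHS]mul1r -(rho1 x) mulr_suml; apply: ler_sum => i _.
  rewrite normrM ger0_norm//.
  have [->|/(hphi i j x)] := eqVneq (rho i x) 0; first by rewrite !mul0r.
  by rewrite distrC => ?; exact: ler_wpM2l.
have evF : `|ev xi u v F - ev xi u v (phi j)| <= e.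
  have cc : continuous (fun _ : X => e) by exact: cst_continuous.
  have A : ev xi u v F <= e + ev xi u v (phi j).
    rewrite -[X in X + _](ev_cst hxi huv) -[X in X + _]mul1r -(ev_lin hxi huv)//.
    apply: ev_le => //.
      by apply: continuous_add => //; exact: continuous_scale.
    by move=> x; have := Fphi x; rewrite ler_norml mul1r => /andP[_]; lra.
  have B : ev xi u v (phi j) <= e + ev xi u v F.
    rewrite -[X in X + _](ev_cst hxi huv) -[X in X + _]mul1r -(ev_lin hxi huv)//.
    apply: ev_le => //.
      by apply: continuous_add => //; exact: continuous_scale.
    by move=> x; have := Fphi x; rewrite ler_norml mul1r => /andP[+ _]; lra.
  by rewrite ler_norml; apply/andP; split; lra.
have err1 : `|(v - u)^-1 * (\sum_(q <- L) q.1 * \sum_(p <- D q.2) p.1 * phi j p.2)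
    - \sum_l kap j l * ev eta u v (psi l)| <= 2 * e.
  rewrite -be_avg -mulrBr -sumrB; under eq_bigr do rewrite -mulrBr.
  exact: (step_avg_le uv hL lift_err).
have := heta j; rewrite FE => err2.
move: err1 err2 evF; rewrite !ler_norml => /andP[a1 a2] /andP[b1 b2] /andP[c1 c2].
by apply/andP; split; lra.
Qed.

Lemma approx_on_eq e (al al' : R -> X) (u v : R) :
  (forall s, u <= s < v -> al s = al' s) -> approx_on e al u v -> approx_on e al' u v.
Proof. by move=> h [L [hL hj]]; exists L; split => //; exact: step_on_eq hL. Qed.

(** The error on the union is the mean of the two errors weighted by length, so the bound [e] is
    kept. *)
Lemma approx_on_cat e (al : R -> X) (u v w : R) :
  0 <= u -> u < v -> v < w -> w <= 1 ->
  approx_on e al u v -> approx_on e al v w -> approx_on e al u w.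
Proof.
move=> u0 uv vw w1 [L1 [h1 a1]] [L2 [h2 a2]].
exists (L1 ++ L2); split; first exact: step_on_cat h1 h2.
move=> j; have := a1 j; have := a2 j; rewrite big_cat/=.
have := ev_concat hxi (@cphi j) u0 uv vw w1.
move: (ev _ u w _) (ev _ u v _) (ev _ v w _) => Euw Euv Evw.
move: (\sum_(p <- L1) _) (\sum_(p <- L2) _) => S1 S2 hE.
have vu : 0 < v - u by lra.
have wv : 0 < w - v by lra.
have wu : 0 < w - u by lra.
have eq (c S E : R) : 0 < c -> (`|c^-1 * S - E| <= e) = (`|S - c * E| <= c * e).
  move=> c0; rewrite -[S in RHS](mulVKf (lt0r_neq0 c0)) -mulrBr normrM.
  by rewrite gtr0_norm// ler_pM2l.
rewrite !eq// hE.
rewrite !ler_norml => /andP[b1 b2] /andP[c1 c2].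
by apply/andP; split; lra.
Qed.

(** Lifts on consecutive intervals are glued at the nodes. All pairs of nodes are covered because
    different coordinates average over different intervals. *)
Lemma path_lift (e u : R) (s : seq R) : 0 < e -> 0 <= u -> path <%R u s ->
  all (fun x => x <= 1) s ->
  \forall eta \near (Hmap R X Y f hf xi : HProd R Y),
    forall be : R -> Y, is_HM be -> H_emb be = eta ->
    exists al : R -> X, (forall t, f (al t) = be t) /\
      forall a b, a \in u :: s -> b \in u :: s -> a < b -> approx_on e al a b.
Proof.
have FF := nbhs_filter (Hmap R X Y f hf xi : HProd R Y).
move=> e0; elim: s u => [|v s IH] u u0 /=.
  move=> _ _; apply: (@filterS _ _ FF setT); last exact: (@filterT _ _ FF).
  move=> eta _ be hbe _; exists (g \o be); split.
    by move=> t; exact: fg.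
  by move=> a b; rewrite !inE => /eqP-> /eqP->; rewrite ltxx.
move=> /andP[uv vs] /andP[v1 s1].
have v0 : 0 <= v by apply: le_trans (ltW uv).
(* [interval_lift] loses a factor [4]. *)
have e4 : 0 < e / 4 by lra.
have huv : subunit u v by [].
have := IH v v0 vs s1; apply: (@filterS2 _ _ FF) (interval_lift huv e4).
move=> eta h1 h2 be hbe ebe.
have [al1 [f1 a1]] := h1 be hbe ebe; have [al2 [f2 a2]] := h2 be hbe ebe.
rewrite (_ : 4 * (e / 4) = e) in a1; last by field.
have vmin x : x \in v :: s -> v <= x.
  rewrite inE => /predU1P[->//|xs].
  by have /allP/(_ x xs)/ltW := order_path_min lt_trans vs.
have le1 x : x \in v :: s -> x <= 1.
  by rewrite inE => /predU1P[->//|xs]; exact: (allP s1).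
exists (fun t => if t < v then al1 t else al2 t); split.
  by move=> t; case: ifP.
have A1 : approx_on e (fun t => if t < v then al1 t else al2 t) u v.
  by apply: approx_on_eq a1 => t /andP[_ ->].
have A2 a b : a \in v :: s -> b \in v :: s -> a < b ->
    approx_on e (fun t => if t < v then al1 t else al2 t) a b.
  move=> av bv ab; apply: approx_on_eq (a2 a b av bv ab) => t /andP[at_ _].
  by rewrite ltNge (le_trans (vmin a av) at_).
move=> a b; rewrite inE => /predU1P[->|av]; rewrite inE => /predU1P[->|bv].
- by rewrite ltxx.
- move=> _; have := vmin b bv; rewrite le_eqVlt => /predU1P[<-//|vb].
  apply: (approx_on_cat u0 uv vb (le1 b bv) A1).
  by apply: A2 => //; rewrite mem_head.
- by move=> /(le_lt_trans (vmin a av))/(lt_trans uv); rewrite ltxx.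
- exact: A2.
Qed.

End IntervalLifting.

(** * Constant step functions embed the space continuously *)

Section Constants.
Context {R : realType} {X : topologicalType}.

Lemma HM_cst (x : X) : is_HM (fun _ : R => x).
Proof. by apply: (@step_on_HM _ _ _ [:: (1, x)]) => /=; rewrite add0r. Qed.

Lemma ev_emb_cst (x : X) (u v : R) (phi : X -> R) :
  continuous phi -> subunit u v -> ev (H_emb (fun=> x)) u v phi = phi x.
Proof.
move=> cp huv; have [_ [uv _]] := huv.
rewrite (ev_emb cp huv (L := [:: (v - u, x)])) /=; last first.
  by rewrite subr_ge0 ltW// subrKC.
by rewrite big_seq1 mulKf// subr_eq0 gt_eqF.
Qed.

Lemma H_emb_cst_continuous :
  continuous (fun x : X => H_emb (fun=> x) : HProd R X).
Proof.
move=> x.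
have FF : Filter ((fun x : X => H_emb (fun=> x) : HProd R X) @ x).
  by apply: fmap_filter; exact: nbhs_filter.
apply: (@ptws_cvg (shm_index R X) R _ (H_emb (fun=> x)) FF) => i.
have e z : H_emb (fun=> z) i = shm_phi i z.
  rewrite [LHS](ev_idx (H_emb (fun=> z))).
  by apply: ev_emb_cst; [exact: shm_cont|exact: shm_ab].
have ee : (fun z : X => H_emb (fun=> z) i) = shm_phi i by exact/funext.
have h : (fun z : X => H_emb (fun=> z) i) @ x --> H_emb (fun=> x) i.
  by rewrite e ee; exact: shm_cont.
exact: h.
Qed.

End Constants.

(** * Compactness of [HX] *)

Section Compactness.
Context {R : realType} {X : topologicalType}.
Hypothesis cX : compact [set: X].

Lemma HX_closed : closed (HX R X).
Proof. exact: closed_closure. Qed.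

Lemma compact_fun_bounded (phi : X -> R) : continuous phi ->
  exists B, forall x, `|phi x| <= B.
Proof.
move=> cp; have /compact_bounded[B [_ hB]] : compact (phi @` [set: X]).
  by apply: continuous_compact => //; exact: continuous_subspaceT.
by exists (B + 1) => x; apply: (hB (B + 1)); [rewrite ltrDl|exists x].
Qed.

(** [HX] is closed and lies in a Tychonoff box, since averages respect the bounds of each test
    function. *)
Lemma HX_compact : compact (HX R X).
Proof.
have [B hB] :=
  choice (fun i : shm_index R X => compact_fun_bounded (@shm_cont R X i)).
have cbox : compact [set xi : HProd R X | forall i, `[- B i, B i]%classic (xi i)].
  apply: (@ptws_compact (shm_index R X) R (fun i => `[- B i, B i]%classic)) => i.
  exact: segment_compact.
apply: subclosed_compact HX_closed cbox _ => xi hxi i /=.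
rewrite in_itv/= (ev_idx xi); have hab := shm_ab i.
have cB c : continuous (fun _ : X => c : R) by exact: cst_continuous.
have Bi x : - B i <= shm_phi i x <= B i by rewrite -ler_norml.
have ci := @shm_cont R X i.
have lo : ev xi (shm_a i) (shm_b i) (fun=> - B i) <=
    ev xi (shm_a i) (shm_b i) (shm_phi i).
  by apply: ev_le => // x; case/andP: (Bi x).
have hi : ev xi (shm_a i) (shm_b i) (shm_phi i) <=
    ev xi (shm_a i) (shm_b i) (fun=> B i).
  by apply: ev_le => // x; case/andP: (Bi x).
by move: lo hi; rewrite !(ev_cst hxi hab) => -> ->.
Qed.

End Compactness.

(** * The two implications *)

Section OpenMaps.
Context {R : realType} {X Y : topologicalType}.
Hypotheses (cX : compact [set: X]) (hX : hausdorff_space X)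
  (cY : compact [set: Y]) (hY : hausdorff_space Y).
Variables (f : X -> Y) (hf : continuous f).

Lemma Hmap_nbhs (fsurj : forall y, exists x, f x = y) (fopen : open_map f)
    (xi : HProd R X) (O : set (HProd R X)) : HX R X xi -> nbhs xi O ->
  \forall eta \near (Hmap R X Y f hf xi : HProd R Y),
    HX R Y eta -> (Hmap R X Y f hf @` (HX R X `&` O)) eta.
Proof.
move=> hxi /ptws_nbhs_box[n [s [e [e0 hO]]]].
have [g fg] := choice fsurj.
(* All endpoints of the given coordinates become nodes; [0] and [1] are added so that the lift is a
   step function on the whole of [0,1). *)
pose P : seq R := sort <=%R (undup (0 :: 1 ::
  [seq shm_a (s j) | j : 'I_n] ++ [seq shm_b (s j) | j : 'I_n])).
have memP x : (x \in P) = [|| x == 0, x == 1,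
    x \in [seq shm_a (s j) | j : 'I_n] | x \in [seq shm_b (s j) | j : 'I_n]].
  by rewrite mem_sort mem_undup !inE mem_cat.
have aP j : shm_a (s j) \in P by rewrite memP fintype.image_f ?orbT.
have bP j : shm_b (s j) \in P by rewrite memP fintype.image_f ?orbT.
have P01 x : x \in P -> 0 <= x <= 1.
  rewrite memP => /or4P[/eqP->|/eqP->|/mapP[j _ ->]|/mapP[j _ ->]];
    rewrite ?lexx ?ler01//; have [a0 [ab b1]] := shm_ab (s j);
    by apply/andP; split; lra.
have Ps : sorted <%R P by rewrite sort_lt_sorted undup_uniq.
have P0 : 0 \in P by rewrite memP eqxx.
have P1 : 1 \in P by rewrite memP eqxx orbT.
case: P memP aP bP P01 Ps P0 P1 => [//|u t] _ aP bP P01 Ps P0 P1.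
have u0 : 0 <= u by case/andP: (P01 u (mem_head _ _)).
have t1 : all (fun x => x <= 1) t.
  apply/allP => x xt; have xP : x \in u :: t by rewrite inE xt orbT.
  by case/andP: (P01 x xP).
have near_lift := path_lift cX cY hY hf fg fopen
  (fun j => @shm_cont R X (s j)) hxi e0 u0 Ps t1.
(* The box is taken closed, so that [K] is compact and its image is closed: it then suffices to
   approximate [eta] by images of points of [K]. *)
pose K := HX R X `&` \bigcap_(j in [set: 'I_n])
  [set x : HProd R X | `|x (s j) - xi (s j)| <= e].
have cK : compact K.
  apply: compact_closedI; first exact: HX_compact.
  apply: closed_bigI => j _.
  have cc : continuous (fun x : HProd R X => `|x (s j) - xi (s j)|).
    apply: continuous_norm; apply: continuous_sub.
      exact: ptws_coord_continuous.
    exact: cst_continuous.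
  have : closed ((fun x : HProd R X => `|x (s j) - xi (s j)|)
                   @^-1` [set r | r <= e]).
    by apply: preimage_closed; [move=> x _; exact: cc|exact: closed_le].
  by [].
have clK : closed (Hmap R X Y f hf @` K).
  apply: compact_closed; first exact: ptws_hausdorff.
  apply: continuous_compact cK; apply: continuous_subspaceT.
  exact: Hmap_continuous.
have FF := nbhs_filter (Hmap R X Y f hf xi : HProd R Y).
(* Passing to the interior makes the lifting property hold on a neighbourhood of [eta], where step
   functions can be found. *)
have := nbhs_interior near_lift.
apply: (@filterS _ _ FF) => eta heta hYeta.
suff : (Hmap R X Y f hf @` K) eta.
  move=> [x [hx hxK] <-]; exists x => //; split => //.
  by apply: hO => j; exact: hxK.
rewrite (iffLR (closure_id _) clK) => W hW.
have [_ [[be hbe <-] [Wbe]]] := hYeta _ (filterI hW heta).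
move=> /(_ be hbe erefl)[al [fal hal]].
have HMal : is_HM al.
  by have [L [hL _]] := hal 0 1 P0 P1 ltr01; exact: step_on_HM hL.
exists (H_emb be); split => //; exists (H_emb al); last first.
  by rewrite Hmap_emb; congr H_emb; apply/funext.
split; first exact: HX_emb.
move=> j _ /=; have hab := shm_ab (s j); have [_ [ab _]] := hab.
have [L [hL /(_ j)]] := hal _ _ (aP j) (bP j) ab.
by rewrite -(ev_emb (@shm_cont R X (s j)) hab hL) -!ev_idx.
Qed.

Lemma Hmap_open (fsurj : forall y, exists x, f x = y) : open_map f ->
  open_map_between (Hmap R X Y f hf) (HX R X) (HX R Y).
Proof.
move=> fopen O oO.
(* The implication turns relative openness in [HX R Y] into the choice of an open set of the ambient
   product. *)
exists [set eta | HX R Y eta -> (Hmap R X Y f hf @` (HX R X `&` O)) eta]°.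
split; first exact: open_interior.
apply/seteqP; split => [_ [xi [hxi Oxi] <-]|eta [hY' /interior_subset]]; last exact.
split; first exact: Hmap_HX.
by apply: Hmap_nbhs => //; exact: open_nbhs_nbhs.
Qed.

Lemma open_of_Hmap_open :
  open_map_between (Hmap R X Y f hf) (HX R X) (HX R Y) -> open_map f.
Proof.
move=> Hopen U oU; rewrite openE => _ [x0 Ux0 <-].
have [|phi [cphi phi01 phix0 phiU]] := @urysohn_bump R X x0 U cX hX.
  exact: open_nbhs_nbhs.
have h01 : @subunit R 0 1 by [].
pose O := [set xi : HProd R X | 1 / 2 < ev xi 0 1 phi].
have oO : open O.
  have : open ((fun xi : HProd R X => ev xi 0 1 phi) @^-1` [set r | 1 / 2 < r]).
    by apply: open_comp; [move=> x _; exact: ev_continuous|exact: open_gt].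
  by [].
have [V [oV eV]] := Hopen O oO.
pose E (y : Y) : HProd R Y := H_emb (fun=> y).
have Vy0 : V (E (f x0)).
  suff : (HX R Y `&` V) (E (f x0)) by case.
  rewrite -eV; exists (H_emb (fun=> x0)) => //; split.
    exact/HX_emb/HM_cst.
  by rewrite /O /= ev_emb_cst// phix0; lra.
have : nbhs (f x0) (E @^-1` V).
  by apply: H_emb_cst_continuous; exact: open_nbhs_nbhs.
apply: filterS => y Vy; apply: contrapT => nfU.
have [xi [hxi Oxi] xiy] : (Hmap R X Y f hf @` (HX R X `&` O)) (E y).
  by rewrite eV; split => //; exact/HX_emb/HM_cst.
pose K := [set x | 1 / 4 <= phi x].
have clfK : closed (f @` K).
  apply: compact_closed => //; apply: continuous_compact.
    exact: continuous_subspaceT.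
  apply: (subclosed_compact _ cX) => //.
  have : closed (phi @^-1` [set t | 1 / 4 <= t]); last by [].
  by apply: preimage_closed; [move=> x _; exact: cphi|exact: closed_ge].
have [|psi [cpsi psi01 psiy psiK]] := @urysohn_bump R Y y (~` (f @` K)) cY hY.
  apply: open_nbhs_nbhs; split; first exact: closed_openC.
  move=> [x Kx fx]; apply: nfU; exists x => //; apply: phiU.
  by apply: lt0r_neq0; apply: lt_le_trans Kx; lra.
have cpf : continuous (psi \o f).
  by move=> x; apply: continuous_comp; [exact: hf|exact: cpsi].
have c54 : continuous (fun _ : X => 5 / 4 : R) by exact: cst_continuous.
(* Pointwise [phi <= 5 / 4 - psi \o f]: on [K] the term [psi \o f] is [0] and [phi <= 1], off [K]
   one has [phi < 1 / 4] and [psi <= 1]. As [xi] lies over the constant [y], the right side averages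
   to [5 / 4 - psi y], which is [1 / 4]. *)
suff : ev xi 0 1 phi <= 1 / 4 by move: Oxi; rewrite /O /=; lra.
have <- : ev xi 0 1 (fun x => -1 * (psi \o f) x + 5 / 4) = 1 / 4.
  rewrite (ev_lin hxi h01)// -ev_Hmap// xiy ev_emb_cst// psiy (ev_cst hxi h01).
  lra.
apply: ev_le => // [|x].
  by apply: continuous_add => //; exact: continuous_scale.
have /andP[p0 p1] := phi01 x; have /andP[q0 q1] := psi01 (f x).
rewrite /=; have [Kx|Kx] := leP (1 / 4) (phi x); last by lra.
suff -> : psi (f x) = 0 by lra.
have [//|psin0] := eqVneq (psi (f x)) 0.
by case: (psiK (f x) psin0); exists x.
Qed.

End OpenMaps.

Theorem theorem1p1 (R : realType) (X Y : topologicalType)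
  (cX : compact [set: X]) (hX : hausdorff_space X)
  (cY : compact [set: Y]) (hY : hausdorff_space Y)
  (f : X -> Y) (hf : continuous f) (fsurj : forall y : Y, exists x : X, f x = y) :
  open_map_between (Hmap R X Y f hf) (HX R X) (HX R Y) <-> open_map f.
Proof. by split; [exact: open_of_Hmap_open|exact: Hmap_open]. Qed.
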